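(* Let $\Phi$ be an oriented surface in $\mathbb{R}^3$ with nowhere vanishing Gaussian curvature such that all the oriented unit normals are distinct from $(0,0,-1)$ and $\Phi^i$ is the graph of a $C^4$ function $f\colon D\to\mathbb{R}$ in a disk $D\subset\mathbb{R}^2$. If through each point of $\Phi$ there passes an oriented sphere of fixed radius $R$ with inwards oriented normals, which is tangent to $\Phi$ along a circular arc (containing the point) of the same radius $R$ but is not tangent to the oriented plane $z=0$ with the normal $(0,0,-1)$, and the plane of the circle is nonparallel to $(0,0,-1)$, then for each $(x,y)\in D$ the two equations $$2(u^2+v^2)(f-xf_x-yf_y-R)+(x^2+y^2+1)(f_{xx}v^2-2f_{xy}uv+f_{yy}u^2)=0,$$ $$(f_{xx}-f_{yy})uv+f_{xy}(v^2-u^2)=0$$ (with $f$ and its derivatives evaluated at $(x,y)$) have a common nonzero real solution $(u,v)$.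
   Context: An oriented surface is the image of a proper injective $C^2$ map of an open disk (or more generally of a smooth $2$-manifold) into $\mathbb{R}^3$ with nondegenerate differential at each point, equipped with oriented unit normals continuously depending on the point. Isotropic model: for an oriented plane $P$ with equation $n_1x+n_2y+n_3z+h=0$, where $(n_1,n_2,n_3)\neq(0,0,-1)$ is its oriented unit normal, let $P^i\in\mathbb{R}^3$ be the point $\left(\frac{n_1}{n_3+1},\frac{n_2}{n_3+1},\frac{h}{n_3+1}\right)$. For an oriented surface $\Phi$, $\Phi^i$ is the set of points $P^i$, where $P$ runs through all oriented tangent planes to $\Phi$ with oriented normals distinct from $(0,0,-1)$. Tangency is oriented tangency: an oriented sphere is tangent to $\Phi$ along an arc if the arc lies on both surfaces and their oriented tangent planes coincide at each point of the arc; a sphere is tangent to an oriented plane if that plane, with its orientation, is one of its oriented tangent planes. *)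

(* Defs.v *)
(* MathComp-Analysis. *)
From HB Require Import structures.
From mathcomp Require Import all_boot all_order all_algebra.
From mathcomp Require Import all_classical all_reals all_analysis.
Set Implicit Arguments.
Unset Strict Implicit.
Unset Printing Implicit Defensive.
Import Order.TTheory GRing.Theory Num.Theory.
Import numFieldNormedType.Exports.
Local Open Scope classical_set_scope.
Local Open Scope ring_scope.

(* The library norm on 'rV[R]_n is the sup norm; Euclidean lengths are always
   expressed through dot. *)
Definition dot (R : realType) (n : nat) (u v : 'rV[R]_n) : R :=
  \sum_(i < n) u 0 i * v 0 i.

Definition vec2 (R : realType) (x y : R) : 'rV[R]_2 :=
  \row_(i < 2) [:: x; y]`_i.

Definition vec3 (R : realType) (x y z : R) : 'rV[R]_3 :=
  \row_(i < 3) [:: x; y; z]`_i.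

Definition disk (R : realType) (o : 'rV[R]_2) (d : R) : set 'rV[R]_2 :=
  [set p | dot (p - o) (p - o) < d ^+ 2].

Definition partial (R : realType) (V : normedModType R) (i : 'I_2)
    (f : 'rV[R]_2 -> V) (p : 'rV[R]_2) : V :=
  'D_(delta_mx 0 i) f p.

(* Meant for open U: the values of f outside U are then irrelevant. *)
Fixpoint Ck (R : realType) (V : normedModType R) (k : nat)
    (U : set 'rV[R]_2) (f : 'rV[R]_2 -> V) : Prop :=
  (forall p, U p -> {for p, continuous f}) /\
  if k is k'.+1 then
    forall i : 'I_2,
      (forall p, U p -> derivable f p (delta_mx 0 i)) /\ Ck k' U (partial i f)
  else True.

(* A homeomorphism from the open set chart_dom onto the open set chart_cod;
   outside these sets the values of the two maps are junk. *)
Record chart (R : realType) (M : topologicalType) := Chart {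
  chart_dom : set M;
  chart_cod : set 'rV[R]_2;
  chart_to : M -> 'rV[R]_2;
  chart_from : 'rV[R]_2 -> M;
  chart_dom_open : open chart_dom;
  chart_cod_open : open chart_cod;
  chart_toP : forall m, chart_dom m -> chart_cod (chart_to m);
  chart_fromP : forall q, chart_cod q -> chart_dom (chart_from q);
  chart_toK : forall m, chart_dom m -> chart_from (chart_to m) = m;
  chart_fromK : forall q, chart_cod q -> chart_to (chart_from q) = q;
  chart_to_cont : forall m, chart_dom m -> {for m, continuous chart_to};
  chart_from_cont : forall q, chart_cod q -> {for q, continuous chart_from}
}.

Record smooth_2manifold (R : realType) := Smooth2Manifold {
  carrier :> topologicalType;
  atlas : set (chart R carrier);
  carrier_hausdorff : hausdorff_space carrier;
  carrier_second_countable : @second_countable carrier;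
  atlas_cover : forall m : carrier, exists2 c, atlas c & chart_dom c m;
  atlas_smooth : forall c1 c2, atlas c1 -> atlas c2 -> forall k,
    Ck k (chart_cod c1 `&` chart_from c1 @^-1` chart_dom c2)
       (chart_to c2 \o chart_from c1)
}.

(* The unit normal at the point [param m] is [normal m].  Properness is that of
   [param] as a map onto the surface, so that a surface need not be a closed
   subset of the space; a map which is proper into the whole space satisfies
   it a fortiori. *)
Record oriented_surface (R : realType) := OrientedSurface {
  source : smooth_2manifold R;
  param : source -> 'rV[R]_3;
  normal : source -> 'rV[R]_3;
  param_C2 : forall c, atlas c ->
    Ck 2 (chart_cod c) (param \o chart_from c);
  param_inj : injective param;
  param_proper : forall K : set 'rV[R]_3,
    compact K -> K `<=` range param -> compact (param @^-1` K);
  param_nondegenerate : forall c, atlas c -> forall q, chart_cod c q ->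
    injective ('d (param \o chart_from c) q);
  normal_continuous : continuous normal;
  normal_unit : forall m, dot (normal m) (normal m) = 1;
  normal_orthogonal : forall c, atlas c -> forall q, chart_cod c q ->
    forall i, dot (partial i (param \o chart_from c) q)
                  (normal (chart_from c q)) = 0
}.

(* (LN - M^2) / (EG - F^2), computed in the chart c. *)
Definition gaussian_curvature (R : realType) (Phi : oriented_surface R)
    (c : chart R (source Phi)) (m : source Phi) : R :=
  let X := @param R Phi \o chart_from c in
  let q := chart_to c m in
  let n := normal m in
  let Xu := partial 0 X in
  let Xv := partial 1 X in
  (dot (partial 0 Xu q) n * dot (partial 1 Xv q) n
     - dot (partial 1 Xu q) n ^+ 2) /
  (dot (Xu q) (Xu q) * dot (Xv q) (Xv q) - dot (Xu q) (Xv q) ^+ 2).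

Definition nowhere_vanishing_curvature (R : realType)
    (Phi : oriented_surface R) : Prop :=
  forall c m, atlas c -> chart_dom c m -> @gaussian_curvature R Phi c m <> 0.

(* The plane dot pl_normal X + pl_offset = 0, oriented by its unit normal;
   all planes below are built from unit normals. *)
Record oplane (R : realType) := OPlane {
  pl_normal : 'rV[R]_3;
  pl_offset : R
}.

Definition plane_at (R : realType) (p n : 'rV[R]_3) : oplane R :=
  OPlane n (- dot n p).

Definition tangent_plane (R : realType) (Phi : oriented_surface R)
    (m : source Phi) : oplane R :=
  plane_at (param m) (normal m).

Definition south (R : realType) : 'rV[R]_3 := vec3 0 0 (- 1).

Definition iso_point (R : realType) (P : oplane R) : 'rV[R]_3 :=
  let n := pl_normal P in
  vec3 (n 0 0 / (n 0 2 + 1)) (n 0 1 / (n 0 2 + 1)) (pl_offset P / (n 0 2 + 1)).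

Definition iso_image (R : realType) (Phi : oriented_surface R) :
    set 'rV[R]_3 :=
  [set Q | exists m : source Phi,
     normal m <> south R /\ Q = iso_point (tangent_plane m)].

Definition graph_over (R : realType) (D : set 'rV[R]_2) (f : 'rV[R]_2 -> R) :
    set 'rV[R]_3 :=
  [set Q | exists2 p, D p & Q = vec3 (p 0 0) (p 0 1) (f p)].

Definition sphere_points (R : realType) (c : 'rV[R]_3) (r : R) :
    set 'rV[R]_3 :=
  [set q | dot (q - c) (q - c) = r ^+ 2].

(* Inward orientation: the unit normal at q points towards the center c. *)
Definition sphere_plane (R : realType) (c : 'rV[R]_3) (r : R)
    (q : 'rV[R]_3) : oplane R :=
  plane_at q (r^-1 *: (c - q)).

Definition sphere_tangent_to_plane (R : realType) (c : 'rV[R]_3) (r : R)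
    (P : oplane R) : Prop :=
  exists2 q, sphere_points c r q & P = sphere_plane c r q.

Record circular_arc (R : realType) := CircularArc {
  arc_center : 'rV[R]_3;
  arc_radius : R;
  arc_e1 : 'rV[R]_3;
  arc_e2 : 'rV[R]_3;
  arc_start : R;
  arc_end : R;
  arc_radius_gt0 : 0 < arc_radius;
  arc_e1_unit : dot arc_e1 arc_e1 = 1;
  arc_e2_unit : dot arc_e2 arc_e2 = 1;
  arc_e1_e2 : dot arc_e1 arc_e2 = 0;
  arc_start_end : arc_start < arc_end
}.

Definition arc_points (R : realType) (A : circular_arc R) : set 'rV[R]_3 :=
  [set q | exists2 t, arc_start A <= t <= arc_end A &
     q = arc_center A + (arc_radius A * cos t) *: arc_e1 A
                      + (arc_radius A * sin t) *: arc_e2 A].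

Definition arc_plane_parallel (R : realType) (A : circular_arc R)
    (w : 'rV[R]_3) : Prop :=
  exists a b : R, w = a *: arc_e1 A + b *: arc_e2 A.

Definition sphere_tangent_along (R : realType) (Phi : oriented_surface R)
    (c : 'rV[R]_3) (r : R) (A : circular_arc R) : Prop :=
  forall q, arc_points A q ->
    sphere_points c r q /\
    exists m : source Phi,
      param m = q /\ tangent_plane m = sphere_plane c r q.

(* Main.v *)
Require Import Defs.
From mathcomp Require Import all_boot all_order all_algebra.
From mathcomp Require Import all_classical all_reals all_analysis.
From mathcomp Require Import ring lra.
Import Order.TTheory GRing.Theory Num.Theory.
Import numFieldNormedType.Exports.
Local Open Scope classical_set_scope.
Local Open Scope ring_scope.
Set Implicit Arguments.
Unset Strict Implicit.
Unset Printing Implicit Defensive.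

(** The oriented planes tangent to the surface have the form
    [n . X + (n3 + 1) f(x, y) = 0], where [(x, y)] is the stereographic image of
    the unit normal [n].  Nonvanishing curvature makes the normal move in all
    directions, so the surface is the envelope of these planes:
    its point with normal [n] is [- (f_x, f_y, F) - F n] with
    [F = f - x f_x - y f_y].  At a point where a sphere with center [c] and
    radius [r] is tangent, this point is also [c - r n], which gives
    [grad f = k (x, y) - (c1, c2)] and [r - F = k / (n3 + 1)] for [k = r + c3].
    Differentiating the first relation along the stereographic image of the arc
    shows that its velocity [a] is an eigenvector of the Hessian of [f] with
    eigenvalue [k]; the solution is [a] rotated by a right angle. *)

(** * Differentiation along lines and curves *)

Lemma is_deriveP (R : numFieldType) (V W : normedModType R) (f : V -> W)
    (x v : V) (l : W) :
  is_derive x v f l <->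
  h^-1 *: (f (h *: v + x) - f x) @[h --> (0 : R)^'] --> l.
Proof.
split; first by case=> dfx <-.
move=> fl; split; first by apply/cvg_ex; exists l.
exact: cvg_lim fl.
Qed.

Lemma is_derive_translate (R : numFieldType) (V W : normedModType R)
    (f : V -> W) (x u v : V) (l : W) :
  is_derive (x + u) v f l -> is_derive x v (fun y => f (y + u)) l.
Proof.
move=> /is_deriveP H; apply/is_deriveP.
by under eq_fun do rewrite -addrA.
Qed.

Lemma is_derive_line (R : numFieldType) (V W : normedModType R)
    (f : V -> W) (x v : V) (s : R) (l : W) :
  is_derive (x + s *: v) v f l ->
  is_derive s 1 (fun t : R => f (x + t *: v)) l.
Proof.
move=> /is_deriveP H; apply/is_deriveP.
under eq_fun do rewrite [_%:A]mulr1 scalerDl addrCA.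
exact: H.
Qed.

(** The one-variable theorem is applied on [0, 1] to the step [t * h], so [h] may have either
    sign. *)
Lemma MVT_line (R : realType) (V : normedModType R) (f f' : V -> R^o)
    (p v : V) (h : R) :
  (forall t : R, 0 <= t <= 1 ->
     is_derive (p + (t * h) *: v) v f (f' (p + (t * h) *: v))) ->
  exists2 t : R, 0 <= t <= 1 &
    f (p + h *: v) - f p = h * f' (p + (t * h) *: v).
Proof.
move=> df.
pose g (t : R) : R := f (p + (t * h) *: v).
have dg (t : R) : 0 <= t <= 1 -> is_derive t 1 g (h * f' (p + (t * h) *: v)).
  move=> /df /is_derive_line dft.
  have dh : is_derive t 1 (fun t : R => t * h) h.
    have := @is_deriveM _ _ id (cst h) t 1 _ _ (is_derive_id _ _)
                 (is_derive_cst _ _ _).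
    by move=> /is_derive_eq; apply; rewrite scaler0 add0r [_ *: _]mulr1.
  have := @is_derive1_comp _ (fun s => f (p + s *: v)) (fun t : R => t * h)
             t _ _ dft dh.
  by move=> /is_derive_eq; apply; exact: mulrC.
have [||t t01] :=
  @MVT_segment R g (fun t => h * f' (p + (t * h) *: v)) 0 1 ler01.
- by move=> t; rewrite in_itv/= => /andP[t0 t1]; apply: dg; rewrite !ltW.
- apply: derivable_within_continuous => t; rewrite in_itv/= => t01.
  exact: (@ex_derive _ _ _ _ _ _ _ (dg t t01)).
rewrite /g mul1r mul0r scale0r addr0 subr0 mulr1 => E.
by exists t => //; move: t01; rewrite in_itv.
Qed.

(** A two-sided derivative is already determined by difference quotients at points of the interval,
    so agreement on one side of [t] suffices; [t] may be an endpoint. *)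
Lemma eq_on_itv_derive (R : realType) (f g : R -> R) (a b t l k : R) :
  a < b -> a <= t <= b -> (forall s, a <= s <= b -> f s = g s) ->
  is_derive t 1 f l -> is_derive t 1 g k -> l = k.
Proof.
move=> ab tab fg df dg; apply/eqP; rewrite -subr_eq0; apply/negPn/negP => lk0.
have dfg : is_derive t 1 (f - g) (l - k) by exact: is_deriveB.
move/is_deriveP : dfg => /cvgrPdist_lt /(_ `|l - k|).
rewrite normr_gt0 => /(_ lk0) [e /= e0 H].
(* An endpoint [c] other than [t] gives a direction into the interval: by convexity [t + d (c - t)]
   with [0 < d <= 1] stays in it. *)
have [c [cab ct]] : exists c, a <= c <= b /\ c != t.
  have [->|at0] := eqVneq t a; first by exists b; rewrite lexx ltW// gt_eqF.
  by exists a; rewrite lexx ltW//= eq_sym.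
(* The bound 1/2 keeps the point in the interval, and the other one keeps the increment below [e].
   The quotient of [f - g] there is zero, yet it should be closer to [l - k] than zero is. *)
pose d := Num.min (1 / 2) (e / (2 * `|c - t|)).
have ct0 : 0 < `|c - t| by rewrite normr_gt0 subr_eq0.
have d0 : 0 < d by rewrite lt_min !divr_gt0// mulr_gt0.
have d1 : d <= 1 / 2 by rewrite ge_min lexx.
have dct : d * `|c - t| <= e / 2.
  rewrite -ler_pdivlMr// (le_trans (y := e / (2 * `|c - t|)))//.
    by rewrite ge_min lexx orbT.
  by rewrite invfM mulrA.
have := H (d * (c - t)).
rewrite /ball/= sub0r normrN normrM (gtr0_norm d0).
have e2 : e / 2 < e by rewrite ltr_pdivrMr// ltr_pMr// ltr1n.
move=> /(_ (le_lt_trans dct e2)).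
rewrite mulf_neq0 ?subr_eq0//; last by rewrite gt_eqF.
have -> : (f - g) ((d * (c - t))%:A + t) = 0.
  rewrite [_%:A]mulr1 /= !fctE; apply/eqP; rewrite subr_eq0; apply/eqP.
  apply: fg.
  by nra.
have -> : (f - g) t = 0.
  by rewrite !fctE; apply/eqP; rewrite subr_eq0; apply/eqP; apply: fg.
by rewrite subrr scaler0 subr0 ltxx => /(_ isT).
Qed.

(** The mean value theorem is used twice: along [v] for the increment of [f] over [h *: w], then
    along [w] for [fv]. *)
Lemma second_difference (R : realType) (V : normedModType R)
    (f fv fvw : V -> R^o) (p v w : V) (h : R) :
  0 <= h ->
  (forall a b : R, 0 <= a <= h -> 0 <= b <= h ->
     is_derive (p + a *: v + b *: w) v f (fv (p + a *: v + b *: w)) /\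
     is_derive (p + a *: v + b *: w) w fv (fvw (p + a *: v + b *: w))) ->
  exists a b : R, [/\ 0 <= a <= h, 0 <= b <= h &
    f (p + h *: v + h *: w) - f (p + h *: v) - (f (p + h *: w) - f p) =
    h * (h * fvw (p + a *: v + b *: w))].
Proof.
move=> h0 H.
have scaled (t : R) : 0 <= t <= 1 -> 0 <= t * h <= h.
  by move=> /andP[t0 t1]; rewrite mulr_ge0//= ler_piMl.
have hh : 0 <= h <= h by rewrite lexx andbT.
have h00 : 0 <= (0 : R) <= h by apply/andP.
pose g (q : V) : R^o := f (q + h *: w) - f q.
pose g' (q : V) : R^o := fv (q + h *: w) - fv q.
have [|t /scaled th] := @MVT_line R V g g' p v h.
  move=> t /scaled th; apply: is_deriveB.
    by apply: is_derive_translate; have [] := H _ _ th hh.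
  by have [] := H _ _ th h00; rewrite scale0r addr0.
rewrite /g/= => ->; rewrite /g'.
have [|s /scaled sh ->] := @MVT_line R V fv fvw (p + (t * h) *: v) w h.
  by move=> s /scaled sh; have [] := H _ _ th sh.
by exists (t * h), (s * h).
Qed.

(** Schwarz's argument: the second difference over a small parallelogram is symmetric in [v] and
    [w], so [fvw] and [fwv] take the same value at two points near [p]; continuity brings both
    points to [p]. *)
Lemma mixed_derivatives_eq (R : realType) (V : normedModType R)
    (f fv fw fvw fwv : V -> R^o) (p v w : V) :
  (\forall q \near p, is_derive q v f (fv q) /\ is_derive q w f (fw q)) ->
  (\forall q \near p, is_derive q w fv (fvw q) /\ is_derive q v fw (fwv q)) ->
  {for p, continuous fvw} -> {for p, continuous fwv} ->
  fvw p = fwv p.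
Proof.
move=> d1 d2 cvw cwv.
apply/eqP; rewrite -subr_eq0 -normr_le0; apply/ler_addgt0Pr => e e0.
rewrite add0r.
have e2 : 0 < e / 2 by rewrite divr_gt0.
move/cvgrPdist_lt : cvw => /(_ _ e2) cvw.
move/cvgrPdist_lt : cwv => /(_ _ e2) cwv.
have : \forall q \near p,
   [/\ is_derive q v f (fv q) /\ is_derive q w f (fw q),
       is_derive q w fv (fvw q) /\ is_derive q v fw (fwv q),
       `|fvw p - fvw q| < e / 2 & `|fwv p - fwv q| < e / 2].
  by near=> q; split; near: q.
move=> /nbhs_ballP[r /= r0 Hr].
(* The summand 1 keeps [n] positive when [v] and [w] vanish; [h] makes the parallelogram with sides
   [h *: v] and [h *: w] fit in the ball of radius [r]. *)
pose n := `|v| + `|w| + 1.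
have n0 : 0 < n by rewrite ltr_wpDl// addr_ge0.
pose h := r / (2 * n).
have h0 : 0 < h by rewrite divr_gt0// mulr_gt0.
have hn : h * (`|v| + `|w|) < r.
  have hnr : h * n = r / 2.
    by rewrite /h invfM mulrA mulfVK// gt_eqF.
  have : h * n < r by rewrite hnr ltr_pdivrMr// ltr_pMr// ltr1n.
  by apply: le_lt_trans; rewrite ler_pM2l// lerDl.
have inball a b : 0 <= a <= h -> 0 <= b <= h -> ball p r (p + a *: v + b *: w).
  move=> /andP[a0 ah] /andP[b0 bh]; rewrite -ball_normE/= -addrA opprD addrA.
  rewrite subrr sub0r normrN (le_lt_trans _ hn)// (le_trans (ler_normD _ _))//.
  by rewrite !normrZ !ger0_norm// mulrDr lerD// ler_wpM2r.
have swap (a b : R) : p + a *: w + b *: v = p + b *: v + a *: w.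
  by rewrite addrAC.
have [|a [b [ah bh E]]] := @second_difference R V f fv fvw p v w h (ltW h0).
  by move=> a b ah bh; have [[? _] [? _]] := Hr _ (inball _ _ ah bh).
have [|a' [b' [ah' bh' E']]] :=
  @second_difference R V f fw fwv p w v h (ltW h0).
  move=> a' b' ah' bh'; rewrite swap.
  by have [[_ ?] [_ ?]] := Hr _ (inball _ _ bh' ah').
have : h * (h * fvw (p + a *: v + b *: w)) =
       h * (h * fwv (p + a' *: w + b' *: v)).
  by rewrite -E -E' swap; ring.
rewrite swap => /(mulfI (lt0r_neq0 h0)) /(mulfI (lt0r_neq0 h0)) EE.
have [_ _ A1 _] := Hr _ (inball _ _ ah bh).
have [_ _ _ A2] := Hr _ (inball _ _ bh' ah').
rewrite -(subrKA (fvw (p + a *: v + b *: w))) EE.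
rewrite (le_trans (ler_normD _ _))// (splitr e) lerD//.
  by rewrite -EE ltW.
by rewrite distrC ltW.
Unshelve. all: by end_near. Qed.

Lemma near_eq_cvg_to (T : Type) (U : topologicalType) (F : set_system T)
    (FF : Filter F) (f g : T -> U) (l : U) :
  (\forall x \near F, f x = g x) -> g x @[x --> F] --> l ->
  f x @[x --> F] --> l.
Proof.
by move=> fg; apply: cvg_trans; apply: near_eq_cvg; apply: filterS fg => x ->.
Qed.

(** Chain rule from continuous partial derivatives: the increment of [f] is split into a step along
    [w] followed by one along [v], and the mean value points of both steps tend to [c t]. *)
Lemma is_derive_along_curve (R : realType) (V : normedModType R)
    (f fv fw : V -> R^o) (p v w : V) (a b : R -> R) (t a' b' : R) :
  let c (s : R) := p + a s *: v + b s *: w in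
  (\forall q \near c t, is_derive q v f (fv q) /\ is_derive q w f (fw q)) ->
  {for c t, continuous fv} -> {for c t, continuous fw} ->
  is_derive t 1 a a' -> is_derive t 1 b b' ->
  is_derive t 1 (fun s => f (c s)) (a' * fv (c t) + b' * fw (c t)).
Proof.
move=> c df cfv cfw /is_deriveP da /is_deriveP db.
(* The increment tends to zero, being [h] times a convergent quotient. *)
have cvg0 (g : R -> R) (g' : R) :
    h^-1 *: (g (h *: 1 + t) - g t) @[h --> (0 : R)^'] --> g' ->
    g (h *: 1 + t) - g t @[h --> (0 : R)^'] --> 0.
  move=> dg; rewrite -[X in _ --> X](mul0r g').
  apply: (@near_eq_cvg_to _ _ _ _ _
    (fun h => h * (h^-1 *: (g (h *: 1 + t) - g t)))).
    near=> h; rewrite mulrA mulfV ?mul1r//.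
    by near: h; exact: nbhs_dnbhs_neq.
  by apply: cvgM => //; apply: cvg_within_filter; exact: cvg_id.
pose da_ (h : R) := a (h *: 1 + t) - a t.
pose db_ (h : R) := b (h *: 1 + t) - b t.
pose rho (h : R) := `|da_ h| * `|v| + `|db_ h| * `|w|.
have rho0 : rho h @[h --> (0 : R)^'] --> 0.
  suff : rho h @[h --> (0 : R)^'] --> `|0 : R| * `|v| + `|0 : R| * `|w|.
    by rewrite normr0 !mul0r addr0.
  by apply: cvgD; apply: cvgMl; apply: cvg_norm;
    [exact: cvg0 da|exact: cvg0 db].
move/nbhs_ballP : df => [r /= r0 df].
(* [P h] holds the two mean value points. When [rho h >= r] both are replaced by [c t], so that the
   distance bounds hold for every [h]. *)
have /choice[P HP] : forall h, exists P : V * V,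
    [/\ `|c t - P.1| <= rho h, `|c t - P.2| <= rho h &
        rho h < r -> f (c (h *: 1 + t)) - f (c t) =
                     da_ h * fv P.1 + db_ h * fw P.2].
  have subD (x : V) : c t - (c t + x) = - x by rewrite opprD addrA subrr sub0r.
  move=> h; have [rhor|] := ltP (rho h) r; last first.
    move=> _; exists (c t, c t) => /=; rewrite subrr normr0; split=> //.
    - by rewrite addr_ge0// mulr_ge0.
    - by rewrite addr_ge0// mulr_ge0.
  have small x y : 0 <= x <= 1 -> 0 <= y <= 1 ->
      `|(x * da_ h) *: v + (y * db_ h) *: w| <= rho h.
    move=> /andP[x0 x1] /andP[y0 y1].
    rewrite (le_trans (ler_normD _ _))// !normrZ lerD//.
      by rewrite ler_wpM2r// ger0_norm// ler_piMl.
    by rewrite ler_wpM2r// ger0_norm// ler_piMl.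
  have near x y : 0 <= x <= 1 -> 0 <= y <= 1 ->
      ball (c t) r (c t + ((x * da_ h) *: v + (y * db_ h) *: w)).
    move=> x01 y01; rewrite -ball_normE/= subD normrN.
    exact: le_lt_trans (small _ _ x01 y01) rhor.
  have i00 : 0 <= (0 : R) <= 1 by apply/andP.
  have i11 : 0 <= (1 : R) <= 1 by apply/andP.
  have [|x x01 Ex] := @MVT_line R V f fv (c t + db_ h *: w) v (da_ h).
    move=> x x01; have := near _ _ x01 i11.
    by rewrite mul1r addrCA addrC => /df[].
  have [|y y01 Ey] := @MVT_line R V f fw (c t) w (db_ h).
    move=> y y01; have := near _ _ i00 y01.
    by rewrite mul0r scale0r add0r => /df[].
  exists (c t + db_ h *: w + (x * da_ h) *: v, c t + (y * db_ h) *: w) => /=.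
  split.
  - rewrite -[X in c t - X]addrA subD normrN addrC.
    by have := small _ _ x01 i11; rewrite mul1r.
  - rewrite subD normrN.
    by have := small _ _ i00 y01; rewrite mul0r scale0r add0r.
  - move=> _; rewrite -Ex -Ey addrA subrK; congr (f _ - _).
    suff: forall x y z z1 z2 : V, x + y + z = x + z1 + z2 + (z - z2) + (y - z1).
      by rewrite /c /da_ /db_ !scalerBl; apply.
    move=> x' y' z z1 z2; rewrite -(addrA (x' + z1) z2) (addrC z2) subrK.
    by rewrite (addrAC x' z1) -(addrA (x' + z)) (addrC z1) subrK addrAC.
have cvgP (g0 : V -> R^o) (k : R -> V) :
    (forall h, `|c t - k h| <= rho h) -> {for c t, continuous g0} ->
    g0 (k h) @[h --> (0 : R)^'] --> g0 (c t).
  move=> kr g0c; apply: continuous_cvg => //.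
  apply/cvgrPdist_lt => e e0; move/cvgrPdist_lt : rho0 => /(_ _ e0).
  apply: filterS => h; rewrite sub0r normrN => /(le_lt_trans (ler_norm _)).
  exact: le_lt_trans.
have cv : fv (P h).1 @[h --> (0 : R)^'] --> fv (c t).
  by apply: (cvgP fv (fun h => (P h).1)) => // h; have [] := HP h.
have cw : fw (P h).2 @[h --> (0 : R)^'] --> fw (c t).
  by apply: (cvgP fw (fun h => (P h).2)) => // h; have [] := HP h.
apply/is_deriveP.
apply: (@near_eq_cvg_to _ _ _ _ _ (fun h =>
  (h^-1 *: da_ h) * fv (P h).1 + (h^-1 *: db_ h) * fw (P h).2));
  last by apply: cvgD; apply: cvgM.
near=> h.
have [_ _ ->] := HP h; first by rewrite -!scalerAl -scalerDr.
apply: le_lt_trans (ler_norm _) _.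
rewrite -normrN -sub0r.
near: h.
by move/cvgrPdist_lt : rho0; apply.
Unshelve. all: by end_near. Qed.

(** * Vectors in space *)

Lemma ord3P (P : 'I_3 -> Prop) : P 0 -> P 1 -> P 2 -> forall i, P i.
Proof.
move=> P0 P1 P2 [[|[|[|//]]] i].
- by rewrite (_ : Ordinal i = 0)//; exact/val_inj.
- by rewrite (_ : Ordinal i = 1)//; exact/val_inj.
- by rewrite (_ : Ordinal i = 2)//; exact/val_inj.
Qed.

Lemma vec3_eta (R : realType) (u : 'rV[R]_3) :
  u = vec3 (u 0 0) (u 0 1) (u 0 2).
Proof.
by apply/rowP; apply: ord3P; rewrite mxE.
Qed.

Lemma vec3E (R : realType) (x y z : R) :
  (vec3 x y z 0 0 = x) * (vec3 x y z 0 1 = y) * (vec3 x y z 0 2 = z).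
Proof. by rewrite !mxE. Qed.

Lemma vec2E (R : realType) (x y : R) :
  (vec2 x y 0 0 = x) * (vec2 x y 0 1 = y).
Proof. by rewrite !mxE. Qed.

Lemma vec3_sum (R : realType) (x y z : R) :
  vec3 x y z = x *: vec3 1 0 0 + y *: vec3 0 1 0 + z *: vec3 0 0 1.
Proof.
apply/rowP; apply: ord3P; rewrite !mxE/=; ring.
Qed.

Lemma vec2_sum (R : realType) (x y : R) :
  vec2 x y = 0 + x *: delta_mx 0 0 + y *: delta_mx 0 1.
Proof.
apply/rowP => -[[|[|//]] i]; rewrite !mxE/=; ring.
Qed.

Lemma dotE (R : realType) (u v : 'rV[R]_3) :
  dot u v = u 0 0 * v 0 0 + u 0 1 * v 0 1 + u 0 2 * v 0 2.
Proof.
rewrite /dot !big_ord_recl big_ord0 addr0 addrA.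
by congr (_ + _ + _); congr (u 0 _ * v 0 _); exact/val_inj.
Qed.

Lemma dotC (R : realType) n (u v : 'rV[R]_n) : dot u v = dot v u.
Proof. by apply: eq_bigr => i _; rewrite mulrC. Qed.

Lemma dotDl (R : realType) n (u v w : 'rV[R]_n) :
  dot (u + v) w = dot u w + dot v w.
Proof. by rewrite -big_split; apply: eq_bigr => i _; rewrite mxE mulrDl. Qed.

Lemma dotZl (R : realType) n (k : R) (u w : 'rV[R]_n) :
  dot (k *: u) w = k * dot u w.
Proof. by rewrite /dot mulr_sumr; apply: eq_bigr => i _; rewrite mxE mulrA. Qed.

Lemma dotBl (R : realType) n (u v w : 'rV[R]_n) :
  dot (u - v) w = dot u w - dot v w.
Proof. by rewrite dotDl -scaleN1r dotZl mulN1r. Qed.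

Definition cross (R : realType) (u v : 'rV[R]_3) : 'rV[R]_3 :=
  vec3 (u 0 1 * v 0 2 - u 0 2 * v 0 1) (u 0 2 * v 0 0 - u 0 0 * v 0 2)
       (u 0 0 * v 0 1 - u 0 1 * v 0 0).

(** Expansion in the dual basis, with the determinant kept as a factor on the left instead of
    dividing by it. *)
Lemma dual_frame (R : realType) (a b c w : 'rV[R]_3) :
  dot (cross a b) c *: w =
  dot a w *: cross b c + dot b w *: cross c a + dot c w *: cross a b.
Proof.
by apply/rowP; apply: ord3P; rewrite !dotE !mxE/=; ring.
Qed.

Lemma dot_cross_sqr (R : realType) (a b c : 'rV[R]_3) :
  dot a c = 0 -> dot b c = 0 ->
  dot (cross a b) c ^+ 2 = (dot a a * dot b b - dot a b ^+ 2) * dot c c.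
Proof.
move=> ac bc.
(* The squared determinant is the Gram determinant of [a], [b], [c]; orthogonality then removes the
   subtracted terms. *)
have : dot (cross a b) c ^+ 2 = (dot a a * dot b b - dot a b ^+ 2) * dot c c
   - (dot a a * dot b c ^+ 2 + dot b b * dot a c ^+ 2
      - 2 * dot a b * dot a c * dot b c).
  by rewrite !dotE !vec3E; ring.
by rewrite ac bc => ->; ring.
Qed.

Section limits.
Context (R : realType) (T : Type) (F : set_system T) (FF : Filter F).

Lemma cvg_coord m n (u : T -> 'M[R]_(m, n)) (l : 'M[R]_(m, n)) i j :
  u t @[t --> F] --> l -> u t i j @[t --> F] --> l i j.
Proof.
pose g := fun M : 'M[R]_(m, n) => (M i j : R).
have gl : {for l, continuous g} by exact: coord_continuous.
exact: (continuous_cvg FF gl).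
Qed.

Lemma cvg_vec3 (x y z : T -> R) (a b c : R) :
  x t @[t --> F] --> a -> y t @[t --> F] --> b -> z t @[t --> F] --> c ->
  vec3 (x t) (y t) (z t) @[t --> F] --> vec3 a b c.
Proof.
move=> xa yb zc; rewrite vec3_sum.
under eq_fun do rewrite vec3_sum.
by apply: cvgD; [apply: cvgD|]; apply: cvgZl.
Qed.

Lemma cvg_dot n (u v : T -> 'rV[R]_n) (a b : 'rV[R]_n) :
  u t @[t --> F] --> a -> v t @[t --> F] --> b ->
  dot (u t) (v t) @[t --> F] --> dot a b.
Proof.
move=> ua vb; apply: cvg_big => [|i _]; first exact: add_continuous.
by apply: cvgM; apply: cvg_coord.
Qed.

Lemma cvg_cross (u v : T -> 'rV[R]_3) (a b : 'rV[R]_3) :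
  u t @[t --> F] --> a -> v t @[t --> F] --> b ->
  cross (u t) (v t) @[t --> F] --> cross a b.
Proof.
move=> ua vb; apply: cvg_vec3;
  by apply: cvgB; apply: cvgM; apply: cvg_coord.
Qed.

End limits.

Lemma is_derive_coord (R : realType) (V : normedModType R) m n
    (M : V -> 'M[R]_(m, n)) (x v : V) (L : 'M[R]_(m, n)) i j :
  is_derive x v M L -> is_derive x v (fun y => M y i j) (L i j).
Proof.
move=> /is_deriveP ML; apply/is_deriveP.
have := cvg_coord (i := i) (j := j) (dnbhs_filter (0 : R)) ML.
by under eq_fun do rewrite !mxE.
Qed.

Lemma is_derive_dot (R : realType) (V : normedModType R)
    (u w : V -> 'rV[R]_3) (x v : V) (a b : 'rV[R]_3) :
  is_derive x v u a -> is_derive x v w b ->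
  is_derive x v (fun y => dot (u y) (w y)) (dot a (w x) + dot (u x) b).
Proof.
move=> ua wb.
have dc i := is_deriveM (is_derive_coord 0 i ua)
                        (is_derive_coord 0 i wb).
have := is_deriveD (is_deriveD (dc 0) (dc 1)) (dc 2).
rewrite (_ : _ + _ = fun y => dot (u y) (w y)); last first.
  by apply/funext => y; rewrite dotE.
by move=> /is_derive_eq; apply; rewrite !dotE /GRing.scale/=; ring.
Qed.

Lemma is_derive_unique (R : numFieldType) (V W : normedModType R)
    (f : V -> W) (x v : V) (k l : W) :
  is_derive x v f k -> is_derive x v f l -> k = l.
Proof. by move=> [_ <-] [_ <-]. Qed.

Lemma is_derive_near_cst (R : numFieldType) (V W : normedModType R)
    (f : V -> W) (x v : V) (k l : W) :
  (\forall y \near x, f y = l) -> is_derive x v f k -> k = 0.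
Proof.
move=> fl df; apply: is_derive_unique (is_derive_cst l x v).
exact: near_eq_is_derive fl df.
Qed.

(* Only the continuity of [n] is assumed: the difference quotient of [n] is
   expanded in the frame dual to [(a t, b t, n (t + h) + n t)], and it is
   orthogonal to the third vector because [n] has constant length. *)
Lemma unit_normal_derivable (R : realType) (a b n : R -> 'rV[R]_3)
    (a' b' : 'rV[R]_3) (t : R) :
  is_derive t 1 a a' -> is_derive t 1 b b' -> {for t, continuous n} ->
  (\forall s \near t, dot (a s) (n s) = 0) ->
  (\forall s \near t, dot (b s) (n s) = 0) ->
  (forall s, dot (n s) (n s) = 1) ->
  dot (a t) (a t) * dot (b t) (b t) - dot (a t) (b t) ^+ 2 != 0 ->
  exists n', [/\ is_derive t 1 n n', dot (n t) n' = 0,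
    dot (a t) n' = - dot a' (n t) & dot (b t) n' = - dot b' (n t)].
Proof.
move=> da db nc an bn n1 gram.
have [ant bnt] : dot (a t) (n t) = 0 /\ dot (b t) (n t) = 0.
  by split; [exact: nbhs_singleton an|exact: nbhs_singleton bn].
pose D := dot (cross (a t) (b t)).
(* The third frame vector tends to [n t + n t], so by the Gram condition the frame stays
   nondegenerate in the limit. *)
have Dn0 : D (n t + n t) != 0.
  rewrite -mulr2n -scaler_nat /D dotC dotZl dotC mulf_neq0 ?pnatr_eq0//.
  by rewrite -sqrf_eq0 dot_cross_sqr// n1 mulr1.
pose w (h : R) := h^-1 *: (n (h *: 1 + t) - n t).
pose c (h : R) := n (h *: 1 + t) + n t.
have sh : h *: 1 + t @[h --> (0 : R)^'] --> t.
  rewrite -[X in _ --> X]add0r; apply: cvgD; last exact: cvg_cst.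
  rewrite -[X in _ --> X](scale0r (1 : R)); apply: cvgZl.
  exact: cvg_within_filter cvg_id.
have nsh : n (h *: 1 + t) @[h --> (0 : R)^'] --> n t.
  exact: (continuous_cvg _ nc sh).
(* As [u] and [n] stay orthogonal, the quotient of [n] against [u t] is minus the quotient of [u]
   against the shifted [n], whose limit requires only continuity of [n]. *)
have wc (u : R -> 'rV[R]_3) u' : is_derive t 1 u u' -> dot (u t) (n t) = 0 ->
    (\forall s \near t, dot (u s) (n s) = 0) ->
    dot (u t) (w h) @[h --> (0 : R)^'] --> - dot u' (n t).
  move=> /is_deriveP du unt un.
  apply: (@near_eq_cvg_to _ _ _ _ _ (fun h =>
    - dot (h^-1 *: (u (h *: 1 + t) - u t)) (n (h *: 1 + t)))).
    near=> h.
    have E : dot (u (h *: 1 + t)) (n (h *: 1 + t)) = 0.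
      by near: h; exact: (sh _ un).
    by rewrite dotZl dotBl E sub0r mulrN opprK dotC dotZl dotBl
       (dotC (n t)) unt subr0 dotC.
  by apply: cvgN; apply: cvg_dot.
have cc : c h @[h --> (0 : R)^'] --> n t + n t.
  by apply: cvgD => //; exact: cvg_cst.
have Dc : D (c h) @[h --> (0 : R)^'] --> D (n t + n t).
  by apply: cvg_dot => //; exact: cvg_cst.
pose l := (D (n t + n t))^-1 *:
  (- dot a' (n t) *: cross (b t) (n t + n t) +
   - dot b' (n t) *: cross (n t + n t) (a t)).
have dn : is_derive t 1 n l.
  apply/is_deriveP.
  apply: (@near_eq_cvg_to _ _ _ _ _ (fun h => (D (c h))^-1 *:
    (dot (a t) (w h) *: cross (b t) (c h) +
     dot (b t) (w h) *: cross (c h) (a t)))).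
    near=> h.
    have Dh0 : D (c h) != 0.
      by near: h; apply: cvgr_neq0 Dc _.
    have cw : dot (c h) (w h) = 0.
      rewrite /c dotC dotZl dotBl !(dotC _ (_ + _)) !dotDl !n1.
      by rewrite (dotC (n t)); ring.
    apply: (scalerI Dh0); rewrite [RHS]scalerA divff// scale1r.
    by rewrite [LHS](dual_frame (a t) (b t) (c h)) cw scale0r addr0.
  by apply: cvgZ; [exact: cvgV|apply: cvgD; apply: cvgZ; try (exact: wc);
    apply: cvg_cross => //; exact: cvg_cst].
have orth (u : R -> 'rV[R]_3) u' : is_derive t 1 u u' ->
    (\forall s \near t, dot (u s) (n s) = 0) -> dot (u t) l = - dot u' (n t).
  move=> du un; have := is_derive_near_cst un (is_derive_dot du dn).
  by move/eqP; rewrite addrC addr_eq0 => /eqP.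
exists l; split=> //; [|exact: orth|exact: orth].
have : \forall s \near t, dot (n s) (n s) = 1 by near=> s; exact: n1.
move=> /is_derive_near_cst /(_ (is_derive_dot dn dn)).
by rewrite (dotC l) => /eqP; rewrite -mulr2n mulrn_eq0/= => /eqP.
Unshelve. all: by end_near. Qed.

(** * Functions of class C^k *)

Lemma open_disk (R : realType) (o : 'rV[R]_2) (d : R) : open (disk o d).
Proof.
rewrite openE => p dp; rewrite /interior.
have dc : dot (q - o) (q - o) @[q --> p] --> dot (p - o) (p - o).
  have po : q - o @[q --> p] --> p - o.
    exact: (@cvgB _ _ _ (nbhs p) _ id (cst o) p o cvg_id (cvg_cst _)).
  exact: (cvg_dot (F := nbhs p) _ po po).
exact: cvgr_lt dc _ dp.
Qed.

Section Ck_theory.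
Context (R : realType) (V : normedModType R) (U : set 'rV[R]_2) (k : nat).
Implicit Types (f : 'rV[R]_2 -> V) (p : 'rV[R]_2).

Lemma Ck_continuous f p : Ck k U f -> U p -> {for p, continuous f}.
Proof. by case: k => [|?] [+ _]; apply. Qed.

Lemma Ck_partial f i : Ck k.+1 U f -> Ck k U (partial i f).
Proof. by case=> _ /(_ i)[]. Qed.

Lemma Ck_is_derive f p i :
  Ck k.+1 U f -> U p -> is_derive p (delta_mx 0 i) f (partial i f p).
Proof. by case=> _ /(_ i)[+ _] => /[apply] /derivableP. Qed.

End Ck_theory.

(** Symmetry of second derivatives is applied to the real function [dot (X q) w] of [q]; with [w]
    the normal it makes the second fundamental form symmetric. *)
Lemma Ck_mixed_dot (R : realType) (U : set 'rV[R]_2) (k : nat)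
    (X : 'rV[R]_2 -> 'rV[R]_3) (p : 'rV[R]_2) (w : 'rV[R]_3) :
  open U -> Ck k.+2 U X -> U p ->
  dot (partial 1 (partial 0 X) p) w = dot (partial 0 (partial 1 X) p) w.
Proof.
move=> oU CX Up.
have nU : \forall q \near p, U q by exact: open_nbhs_nbhs.
have dw (Y : 'rV[R]_2 -> 'rV[R]_3) q i j : Ck j.+1 U Y -> U q ->
    is_derive q (delta_mx 0 i) (fun q => dot (Y q) w : R^o)
      (dot (partial i Y q) w).
  move=> CY Uq.
  have := is_derive_dot (Ck_is_derive i CY Uq) (is_derive_cst w q _).
  by move=> /is_derive_eq; apply; rewrite dotE [dot (Y q) 0]dotE !mxE; ring.
have cw (Y : 'rV[R]_2 -> 'rV[R]_3) j : Ck j U Y ->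
    {for p, continuous (fun q => dot (Y q) w : R^o)}.
  move=> CY; have Yc := Ck_continuous CY Up.
  exact: (cvg_dot (F := nbhs p) _ Yc (cvg_cst w)).
pose g (Y : 'rV[R]_2 -> 'rV[R]_3) q : R^o := dot (Y q) w.
apply: (@mixed_derivatives_eq _ _ (g X) (g (partial 0 X)) (g (partial 1 X))
  (g (partial 1 (partial 0 X))) (g (partial 0 (partial 1 X))) p
  (delta_mx 0 0) (delta_mx 0 1)).
- by apply: filterS nU => q Uq; split; apply: dw CX Uq.
- by apply: filterS nU => q Uq; split; apply: dw Uq; apply: Ck_partial CX.
- exact: cw (Ck_partial 1 (Ck_partial 0 CX)).
- exact: cw (Ck_partial 0 (Ck_partial 1 CX)).
Qed.

Lemma Ck_mixed (R : realType) (U : set 'rV[R]_2) (k : nat)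
    (f : 'rV[R]_2 -> R^o) (p : 'rV[R]_2) :
  open U -> Ck k.+2 U f -> U p ->
  partial 1 (partial 0 f) p = partial 0 (partial 1 f) p.
Proof.
move=> oU Cf Up.
have nU : \forall q \near p, U q by exact: open_nbhs_nbhs.
have Cf0 := Ck_partial 0 Cf; have Cf1 := Ck_partial 1 Cf.
apply: (@mixed_derivatives_eq _ _ f (partial 0 f) (partial 1 f) _ _ p
  (delta_mx 0 0) (delta_mx 0 1)).
- by apply: filterS nU => q Uq; split; exact: (Ck_is_derive _ Cf Uq).
- apply: filterS nU => q Uq.
  by split; [exact: (Ck_is_derive _ Cf0 Uq)|exact: (Ck_is_derive _ Cf1 Uq)].
- exact: Ck_continuous (Ck_partial 1 Cf0) Up.
- exact: Ck_continuous (Ck_partial 0 Cf1) Up.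
Qed.

Lemma Ck_along_curve (R : realType) (U : set 'rV[R]_2) (k : nat)
    (f : 'rV[R]_2 -> R^o) (x y : R -> R) (t x' y' : R) :
  let p := vec2 (x t) (y t) in
  open U -> Ck k.+1 U f -> U p ->
  is_derive t 1 x x' -> is_derive t 1 y y' ->
  is_derive t 1 (fun s => f (vec2 (x s) (y s)))
    (x' * partial 0 f p + y' * partial 1 f p).
Proof.
move=> p oU Cf Up dx dy.
rewrite (_ : (fun s => _) = fun s => f (0 + x s *: delta_mx 0 0 +
  y s *: delta_mx 0 1)); last by apply/funext => s; rewrite vec2_sum.
rewrite /p vec2_sum; move: Up; rewrite /p vec2_sum => Up.
have nU := open_nbhs_nbhs (conj oU Up).
apply: is_derive_along_curve => //.
- by apply: filterS nU => q Uq; split; exact: (Ck_is_derive _ Cf Uq).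
- exact: Ck_continuous (Ck_partial 0 Cf) Up.
- exact: Ck_continuous (Ck_partial 1 Cf) Up.
Qed.

(** * Envelopes of planes and surfaces *)

(** By the Binet-Cauchy identity the nonzero determinant is [dot (cross a b) (cross u v)], so [u]
    and [v] are independent and their cross product spans the line of [n]; a vector orthogonal to
    both lies on that line. *)
Lemma orthogonal_complement (R : realType) (a b u v n k : 'rV[R]_3) :
  dot n n = 1 -> dot n u = 0 -> dot n v = 0 ->
  dot a u * dot b v - dot a v * dot b u != 0 ->
  dot u k = 0 -> dot v k = 0 -> k = dot n k *: n.
Proof.
move=> nn nu nv; set D := dot (cross u v) n => II uk vk.
have uvn : cross u v = D *: n.
  rewrite [RHS](dual_frame u v n) !(dotC _ n) nu nv nn.
  by rewrite !scale0r !add0r scale1r.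
have D0 : D != 0.
  apply: contra_neq II => D0.
  have : dot (cross a b) (cross u v) = 0.
    by rewrite uvn D0 scale0r dotE !mxE !mulr0 !addr0.
  by move=> <-; rewrite !dotE !vec3E; ring.
apply: (scalerI D0); rewrite [LHS](dual_frame u v n) uk vk !scale0r !add0r.
by rewrite uvn !scalerA mulrC.
Qed.

(** Stereographic projection from the south pole; its coordinates are those with indices 0 and 1. *)
Definition stereo (R : realType) (n : 'rV[R]_3) (i : 'I_3) : R :=
  n 0 i / (n 0 2 + 1).

Lemma is_derive_stereo (R : realType) (n : R -> 'rV[R]_3) (n' : 'rV[R]_3)
    (t : R) (i : 'I_3) :
  is_derive t 1 n n' -> n t 0 2 + 1 != 0 ->
  is_derive t 1 (fun s => stereo (n s) i)
    ((n' 0 i - stereo (n t) i * n' 0 2) / (n t 0 2 + 1)).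
Proof.
move=> dn n0.
have dc j := is_derive_coord 0 j dn.
have d2 : is_derive t 1 (fun s => n s 0 2 + 1) (n' 0 2).
  have := is_deriveD (dc 2) (is_derive_cst (1 : R) t 1).
  by move=> /is_derive_eq; apply; rewrite addr0.
have := is_deriveM (dc i) (@is_deriveV _ (fun s => n s 0 2 + 1) _ _ _ n0 d2).
by move=> /is_derive_eq; apply; rewrite /stereo /GRing.scale/=; field.
Qed.

Section envelope.
Context (R : realType) (U : set 'rV[R]_2) (k : nat)
  (f : 'rV[R]_2 -> R^o).
Hypotheses (oU : open U) (Cf : Ck k.+1 U f).

(** Minus the Legendre transform of [f], as a function of the point rather than of the slope. *)
Definition legendre (p : 'rV[R]_2) : R :=
  f p - p 0 0 * partial 0 f p - p 0 1 * partial 1 f p.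

(** The Euclidean gradient of [(n3 + 1) f(n1 / (n3 + 1), n2 / (n3 + 1))] in the free vector [n]. *)
Definition lift_grad (p : 'rV[R]_2) : 'rV[R]_3 :=
  vec3 (partial 0 f p) (partial 1 f p) (legendre p).

(** Differentiating the plane equation leaves only the motion of [n]: the contribution of [q']
    vanishes by tangency, and the offset term contributes [dot n' (lift_grad p)]. *)
Lemma envelope_curve (n q : R -> 'rV[R]_3) (n' q' : 'rV[R]_3) (t : R) :
  let p := vec2 (stereo (n t) 0) (stereo (n t) 1) in
  is_derive t 1 n n' -> is_derive t 1 q q' -> n t 0 2 + 1 != 0 -> U p ->
  dot (n t) q' = 0 ->
  (\forall s \near t, (n s 0 2 + 1) *
     f (vec2 (stereo (n s) 0) (stereo (n s) 1)) + dot (n s) (q s) = 0) ->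
  dot n' (q t + lift_grad p) = 0.
Proof.
move=> p dn dq n0 Up nq' Heq.
have df := @Ck_along_curve _ _ _ _ (fun s => stereo (n s) 0)
  (fun s => stereo (n s) 1) t _ _ oU Cf Up
  (is_derive_stereo 0 dn n0) (is_derive_stereo 1 dn n0).
have d2 : is_derive t 1 (fun s => n s 0 2 + 1) (n' 0 2).
  have := is_deriveD (is_derive_coord 0 2 dn) (is_derive_cst (1 : R) t 1).
  by move=> /is_derive_eq; apply; rewrite addr0.
have := is_deriveD (is_deriveM d2 df) (is_derive_dot dn dq).
move=> /(is_derive_near_cst Heq); rewrite nq' addr0 -/p => E.
rewrite dotC dotDl (dotC _ n') (dotC _ n') addrC -[RHS]E; congr (_ + _).
rewrite dotE !vec3E /legendre !vec2E /GRing.scale/=.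
by field.
Qed.

End envelope.

Lemma unit_neq_south (R : realType) (n : 'rV[R]_3) :
  dot n n = 1 -> n <> south R -> n 0 2 + 1 != 0.
Proof.
move=> n1 ns; apply: contra_notN ns; rewrite addr_eq0 => /eqP n2.
have n01 : n 0 0 * n 0 0 + n 0 1 * n 0 1 = 0.
  by move: n1; rewrite dotE n2; lra.
have n00 : n 0 0 = 0 by nra.
have n010 : n 0 1 = 0 by nra.
by rewrite (vec3_eta n) n00 n010 n2.
Qed.

Section surface.
Context (R : realType) (Phi : oriented_surface R) (U : set 'rV[R]_2)
  (k : nat) (f : 'rV[R]_2 -> R^o).
Hypotheses (hK : nowhere_vanishing_curvature Phi)
  (hn : forall m : source Phi, normal m <> south R)
  (oU : open U) (Cf : Ck k.+1 U f) (hgraph : iso_image Phi = graph_over U f).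
Implicit Type m : source Phi.

Definition gauss_point m : 'rV[R]_2 :=
  vec2 (stereo (normal m) 0) (stereo (normal m) 1).

Lemma normal_third_neq0 m : normal m 0 2 + 1 != 0.
Proof. exact (unit_neq_south (normal_unit m) (@hn m)). Qed.

Lemma graph_equation m :
  U (gauss_point m) /\
  (normal m 0 2 + 1) * f (gauss_point m) + dot (normal m) (param m) = 0.
Proof.
have : iso_image Phi (iso_point (tangent_plane m)) by exists m.
rewrite hgraph => -[p Up E].
have e0 := congr1 (fun u : 'rV[R]_3 => u 0 0) E.
have e1 := congr1 (fun u : 'rV[R]_3 => u 0 1) E.
have e2 := congr1 (fun u : 'rV[R]_3 => u 0 2) E.
rewrite /= !vec3E in e0 e1 e2.
have -> : gauss_point m = p.
  apply/rowP => -[[|[|//]] i]; rewrite mxE/=.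
    by rewrite [LHS]e0; congr (p 0 _); exact/val_inj.
  by rewrite [LHS]e1; congr (p 0 _); exact/val_inj.
by split=> //; rewrite -e2 mulrC divfK ?normal_third_neq0// addNr.
Qed.

(** Nonzero curvature provides two independent velocities of the normal. By [envelope_curve] both
    are orthogonal to the sum of [param m] and the lifted gradient, which is thus a multiple of the
    normal; the plane equation fixes the factor. *)
Lemma surface_point m :
  param m = - lift_grad f (gauss_point m)
            - legendre f (gauss_point m) *: normal m.
Proof.
have [c Ac cm] := atlas_cover m.
pose X := @param R Phi \o chart_from c.
pose q := chart_to c m.
have Kc : chart_from c q = m by exact: chart_toK.
have cq : chart_cod c q by exact: chart_toP.
have CX : Ck 2 (chart_cod c) X by exact: param_C2.
have oc := @chart_cod_open _ _ c.
pose N := normal m.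
have := hK Ac cm; rewrite /gaussian_curvature -/X -/q -/N.
set LN := _ - _; set G := _ - _ => /eqP.
rewrite mulf_eq0 invr_eq0 negb_or => /andP[LN0 G0].
(* Along the [i]-th coordinate line of the chart the normal has a velocity [n'] whose products with
   the tangent vectors are minus coefficients of the second fundamental form. *)
have rotate i : exists n', [/\ dot N n' = 0,
    dot (partial 0 X q) n' = - dot (partial i (partial 0 X) q) N,
    dot (partial 1 X q) n' = - dot (partial i (partial 1 X) q) N &
    dot n' (param m + lift_grad f (gauss_point m)) = 0].
  pose e : 'rV[R]_2 := delta_mx 0 i.
  pose n (s : R) := normal (chart_from c (q + s *: e)).
  have q0 : q + (0 : R) *: e = q by rewrite scale0r addr0.
  have n0 : n 0 = N by rewrite /n q0 Kc.
  have line_cvg : q + s *: e @[s --> (0 : R)] --> q.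
    rewrite -[X in _ --> X]q0; apply: cvgD; first exact: cvg_cst.
    by apply: cvgZl; exact: cvg_id.
  have nearU : \forall s \near (0 : R), chart_cod c (q + s *: e).
    exact: line_cvg _ (open_nbhs_nbhs (conj oc cq)).
  have dline (Y : 'rV[R]_2 -> 'rV[R]_3) j : Ck j.+1 (chart_cod c) Y ->
      is_derive (0 : R) 1 (fun s => Y (q + s *: e)) (partial i Y q).
    move=> CY; apply: is_derive_line; rewrite q0.
    exact: Ck_is_derive CY cq.
  have nc : {for (0 : R), continuous n}.
    have from_cvg : chart_from c (q + s *: e) @[s --> (0 : R)] --> m.
      rewrite -Kc; apply: (continuous_cvg _ _ line_cvg).
      exact: chart_from_cont.
    suff: n s @[s --> (0 : R)] --> N by rewrite -n0.
    apply: (continuous_cvg _ _ from_cvg).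
    exact: normal_continuous.
  have orth j : \forall s \near (0 : R),
      dot (partial j X (q + s *: e)) (n s) = 0.
    by apply: filterS nearU => s Us; exact: normal_orthogonal.
  have [||n' [dn nn' a' b']] := @unit_normal_derivable _ _ _ _ _ _ 0
    (dline _ _ (Ck_partial 0 CX)) (dline _ _ (Ck_partial 1 CX)) nc
    (orth 0) (orth 1).
  - by move=> s; exact: normal_unit.
  - by rewrite q0.
  rewrite n0 q0 in nn' a' b'.
  exists n'; split=> //.
  have := @envelope_curve R U k f oU Cf n (fun s => X (q + s *: e)) n'
    (partial i X q) 0 dn (dline _ _ CX).
  rewrite n0 q0 /X/= Kc; apply => //.
  - exact: normal_third_neq0.
  - by have [] := graph_equation m.
  - rewrite dotC /N -Kc; exact: normal_orthogonal.
  - near=> s; have [_] := graph_equation (chart_from c (q + s *: e)).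
    exact.
have [u [Nu u0 u1 uk]] := rotate 0.
have [v [Nv v0 v1 vk]] := rotate 1.
(* Turns the determinant of these products into the numerator of the curvature; [M] and [M'] are the
   mixed coefficients in the two orders of differentiation. *)
have det (a b c' d L M M' P : R) : a = - L -> b = - P -> c' = - M -> d = - M' ->
    M = M' -> a * b - c' * d = L * P - M ^+ 2.
  by move=> -> -> -> -> ->; rewrite !mulrNN.
have II : dot (partial 0 X q) u * dot (partial 1 X q) v -
          dot (partial 0 X q) v * dot (partial 1 X q) u != 0.
  by rewrite (det _ _ _ _ _ _ _ _ u0 v1 v0 u1 (Ck_mixed_dot N oc CX cq)).
have E := orthogonal_complement (normal_unit m) Nu Nv II uk vk.
have [_ gr] := graph_equation m.
have m3 := normal_third_neq0 m.
have : dot N (param m + lift_grad f (gauss_point m)) =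
  - legendre f (gauss_point m).
  rewrite dotC dotDl !(dotC _ N).
  move/eqP: gr; rewrite addrC addr_eq0 => /eqP ->.
  by rewrite dotE !vec3E /legendre !vec2E /stereo -/N; field.
move=> EN; move/eqP: E; rewrite EN scaleNr -subr_eq0 opprK => /eqP E.
by apply/eqP; rewrite -subr_eq0 opprD !opprK addrA E.
Unshelve. all: by end_near. Qed.

End surface.

(** * Tangency along an arc *)

Lemma is_derive_scalel (R : realType) (V : normedModType R) (g : R -> R)
    (t g' : R) (v : V) :
  is_derive t 1 g g' -> is_derive t 1 (fun s => g s *: v) (g' *: v).
Proof.
move=> /is_deriveP dg; apply/is_deriveP.
by under eq_fun do rewrite -scalerBl scalerA; exact: cvgZl dg.
Qed.

Definition arc_param (R : realType) (A : circular_arc R) (t : R) : 'rV[R]_3 :=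
  arc_center A + (arc_radius A * cos t) *: arc_e1 A
               + (arc_radius A * sin t) *: arc_e2 A.

Definition arc_velocity (R : realType) (A : circular_arc R) (t : R) :
    'rV[R]_3 :=
  (arc_radius A * - sin t) *: arc_e1 A + (arc_radius A * cos t) *: arc_e2 A.

Lemma is_derive_arc (R : realType) (A : circular_arc R) (t : R) :
  is_derive t 1 (arc_param A) (arc_velocity A t).
Proof.
have dc : is_derive t 1 (fun s => arc_radius A * cos s)
    (arc_radius A * - sin t) by exact: is_deriveZ.
have ds : is_derive t 1 (fun s => arc_radius A * sin s)
    (arc_radius A * cos t) by exact: is_deriveZ.
have := is_deriveD (is_deriveD (is_derive_cst (arc_center A) t 1)
  (is_derive_scalel (arc_e1 A) dc)) (is_derive_scalel (arc_e2 A) ds).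
by move=> /is_derive_eq; apply; rewrite add0r.
Qed.

Lemma dot_arc_velocity (R : realType) (A : circular_arc R) (t : R) :
  dot (arc_velocity A t) (arc_velocity A t) = arc_radius A ^+ 2.
Proof.
rewrite dotDl !dotZl !(dotC _ (_ + _)) !dotDl !dotZl (dotC (arc_e2 A)).
rewrite arc_e1_unit arc_e2_unit arc_e1_e2 !mulr0 !mulr1 addr0 add0r.
by rewrite -[RHS]mulr1 -(cos2Dsin2 t); ring.
Qed.

(** The last two equations say that the differential of the stereographic projection kills [n'];
    together with tangency to the unit sphere they give [(n3 + 1) n'3 = 0]. *)
Lemma stereo_immersion (R : realType) (n n' : 'rV[R]_3) :
  dot n n = 1 -> dot n n' = 0 -> n 0 2 + 1 != 0 ->
  n' 0 0 = stereo n 0 * n' 0 2 -> n' 0 1 = stereo n 1 * n' 0 2 -> n' = 0.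
Proof.
rewrite !dotE /stereo => n1 nn' n3 e0 e1.
have e2 : n' 0 2 = 0.
  have : (n 0 0 * n 0 0 + n 0 1 * n 0 1 + n 0 2 * n 0 2 + n 0 2) * n' 0 2 = 0.
    by rewrite -[RHS](mul0r (n 0 2 + 1)) -nn' e0 e1; field.
  by rewrite n1 addrC => /eqP; rewrite mulf_eq0 (negPf n3) => /eqP.
by apply/rowP; apply: ord3P; rewrite mxE ?e0 ?e1 e2 ?mulr0.
Qed.

Lemma stereo_sqr (R : realType) (n : 'rV[R]_3) :
  dot n n = 1 -> n 0 2 + 1 != 0 ->
  (stereo n 0 ^+ 2 + stereo n 1 ^+ 2 + 1) * (n 0 2 + 1) = 2.
Proof.
rewrite dotE /stereo => n1 n3.
(* The bracket added to [2 (n3 + 1)] is zero and makes the numerator [n1^2 + n2^2 + (n3 + 1)^2]. *)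
have -> : 2 = (2 * (n 0 2 + 1) +
    (n 0 0 * n 0 0 + n 0 1 * n 0 1 + n 0 2 * n 0 2 - 1)) / (n 0 2 + 1) :> R.
  by rewrite n1; field.
by field.
Qed.

(** With [(u, v) = (-b, a)] the quadratic form of the first equation is the Hessian form at its
    eigenvector [(a, b)], that is [k (a^2 + b^2)]. The second expression is the determinant of
    [(a, b)] and its image under the Hessian, which are parallel. *)
Lemma contact_algebra (R : realFieldType) (a b k F r S N A B C : R) :
  a * A + b * B = k * a -> a * B + b * C = k * b ->
  (r - F) * N = k -> S * N = 2 ->
  2 * ((- b) ^+ 2 + a ^+ 2) * (F - r) +
    S * (A * a ^+ 2 - 2 * B * (- b) * a + C * (- b) ^+ 2) = 0 /\
  (A - C) * (- b) * a + B * (a ^+ 2 - (- b) ^+ 2) = 0.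
Proof.
move=> H0 H1 Hk SN; split.
  have -> : A * a ^+ 2 - 2 * B * (- b) * a + C * (- b) ^+ 2 =
      a * (a * A + b * B) + b * (a * B + b * C) by ring.
  rewrite H0 H1 -Hk.
  have -> : S * (a * ((r - F) * N * a) + b * ((r - F) * N * b)) =
      (S * N) * (r - F) * (a ^+ 2 + b ^+ 2) by ring.
  by rewrite SN; ring.
have -> : (A - C) * (- b) * a + B * (a ^+ 2 - (- b) ^+ 2) =
    a * (a * B + b * C) - b * (a * A + b * B) by ring.
by rewrite H0 H1; ring.
Qed.

Theorem corollary29 (R : realType) (Phi : oriented_surface R)
    (o : 'rV[R]_2) (d : R) (f : 'rV[R]_2 -> R^o) (r : R)
    (hK : nowhere_vanishing_curvature Phi)
    (hn : forall m : source Phi, normal m <> south R)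
    (hd : 0 < d)
    (hf : Ck 4 (disk o d) f)
    (hgraph : iso_image Phi = graph_over (disk o d) f)
    (hr : 0 < r)
    (hsphere : forall m : source Phi,
      exists (c : 'rV[R]_3) (A : circular_arc R),
        [/\ arc_radius A = r,
            arc_points A (param m),
            sphere_tangent_along Phi c r A,
            ~ sphere_tangent_to_plane c r (OPlane (south R) 0)
          & ~ arc_plane_parallel A (south R)]) :
  forall x y : R, disk o d (vec2 x y) ->
    let p := vec2 x y in
    let fx := partial 0 f in
    let fy := partial 1 f in
    let fxx := partial 0 fx in
    let fxy := partial 1 fx in
    let fyy := partial 1 fy in
    exists u v : R,
      [/\ (u, v) <> (0, 0),
          2 * (u ^+ 2 + v ^+ 2) * (f p - x * fx p - y * fy p - r)
            + (x ^+ 2 + y ^+ 2 + 1)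
              * (fxx p * v ^+ 2 - 2 * fxy p * u * v + fyy p * u ^+ 2) = 0
        & (fxx p - fyy p) * u * v + fxy p * (v ^+ 2 - u ^+ 2) = 0].
Proof.
move=> x y Dxy p fx fy fxx fxy fyy.
have oD := @open_disk R o d.
have [m [_ Em]] : iso_image Phi (vec3 x y (f p)).
  by rewrite hgraph; exists p => //; rewrite !vec2E.
have sp := @surface_point R Phi (disk o d) 3 f hK hn oD hf hgraph.
have pm : gauss_point m = p.
  have e0 := congr1 (fun u : 'rV[R]_3 => u 0 0) Em.
  have e1 := congr1 (fun u : 'rV[R]_3 => u 0 1) Em.
  rewrite /= !vec3E in e0 e1.
  by rewrite /p e0 e1.
have [c [A [Ar [t0 t0A pt0] tan _ _]]] := hsphere m.
(* The inward unit normal of the sphere along the arc; by tangency it is also the normal of the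
   surface there. *)
pose n (s : R) := r^-1 *: (c - arc_param A s).
pose g (s : R) := vec2 (stereo (n s) 0) (stereo (n s) 1).
have onarc s : arc_start A <= s <= arc_end A -> exists m' : source Phi,
    param m' = arc_param A s /\ normal m' = n s.
  move=> sA; have [_ [m' [pm' [nm' _]]]] := tan _ (ex_intro2 _ _ s sA erefl).
  by exists m'.
have r0 : r != 0 by rewrite gt_eqF.
(* Injectivity of [param] identifies the point supplied by tangency at [t0] with [m]. *)
have nt0 : normal m = n t0.
  have [m' [pm' <-]] := onarc _ t0A.
  by congr normal; apply: (@param_inj R Phi); rewrite pm' pt0.
have gt0 : g t0 = p by rewrite -pm /g -nt0.
pose k := r + c 0 2.
(* Compares [c - r n] with [- lift_grad - F n] for the same point. The third coordinate gives the
   last relation, which in the other two turns [(r - F) n_i] into [k] times a stereographic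
   coordinate. *)
have contact s : arc_start A <= s <= arc_end A ->
    [/\ partial 0 f (g s) = k * stereo (n s) 0 - c 0 0,
        partial 1 f (g s) = k * stereo (n s) 1 - c 0 1 &
        (r - legendre f (g s)) * (n s 0 2 + 1) = k].
  move=> sA; have [m' [pm' nm']] := onarc s sA.
  have n3 := @normal_third_neq0 R Phi hn m'; rewrite nm' in n3.
  have := sp m'; rewrite /gauss_point nm' pm' -/(g s).
  have -> : arc_param A s = c - r *: n s.
    by rewrite /n scalerA divff// scale1r opprB addrC subrK.
  move=> E.
  have coord (u v w : 'rV[R]_3) (a b : R) i : u - a *: v = - w - b *: v ->
      u 0 i - a * v 0 i = - w 0 i - b * v 0 i.
    by move=> /(congr1 (fun z : 'rV[R]_3 => z 0 i)); rewrite !mxE.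
  have e i := coord _ _ _ _ _ i E.
  have := (e 0, e 1, e 2); rewrite /lift_grad !vec3E => -[[e0 e1] e2].
  have L : (r - legendre f (g s)) * (n s 0 2 + 1) = k by rewrite /k; lra.
  have ratio i : k * stereo (n s) i = (r - legendre f (g s)) * n s 0 i.
    by rewrite -L /stereo -mulrA [X in _ * X]mulrC divfK.
  by split=> //; rewrite ratio; lra.
pose n' : 'rV[R]_3 := - r^-1 *: arc_velocity A t0.
have dn : is_derive t0 1 n n'.
  have := is_deriveZ r^-1
    (is_deriveB (is_derive_cst c t0 1) (is_derive_arc A t0)).
  by move=> /is_derive_eq; apply; rewrite /n' sub0r scalerN scaleNr.
have nn s : arc_start A <= s <= arc_end A -> dot (n s) (n s) = 1.
  by move=> sA; have [m' [_ <-]] := onarc s sA; exact: normal_unit.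
have AA := arc_start_end A.
(* The unit length of [n] is known on the closed parameter interval, of which [t0] may be an
   endpoint; hence [eq_on_itv_derive]. *)
have nn' : dot (n t0) n' = 0.
  have := eq_on_itv_derive AA t0A nn (is_derive_dot dn dn)
    (is_derive_cst (1 : R) t0 1).
  rewrite (dotC n') -mulr2n => /eqP; rewrite mulrn_eq0/= => /eqP.
  exact.
(* Arc and sphere have the same radius, so [n] moves at unit speed. *)
have n'0 : n' != 0.
  apply/eqP => n'0; have : dot n' n' = 1.
    rewrite /n' dotZl dotC dotZl dot_arc_velocity Ar; field.
    exact: r0.
  by rewrite n'0 dotE !mxE !mulr0 !addr0 => /eqP; rewrite eq_sym oner_eq0.
have n3 : n t0 0 2 + 1 != 0.
  by rewrite -nt0; exact (@normal_third_neq0 R Phi hn m).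
pose a i := (n' 0 i - stereo (n t0) i * n' 0 2) / (n t0 0 2 + 1).
have dx i : is_derive t0 1 (fun s => stereo (n s) i) (a i).
  exact: is_derive_stereo.
(* Differentiating the gradient relations gives the eigenvector equation row by row; [j] numbers a
   variable of the plane and [i] the matching space coordinate. *)
have hessian (j : 'I_2) (i : 'I_3) :
    (forall s, arc_start A <= s <= arc_end A ->
      partial j f (g s) = k * stereo (n s) i - c 0 i) ->
    a 0 * partial 0 (partial j f) p + a 1 * partial 1 (partial j f) p = k * a i.
  move=> H.
  have Dg : disk o d (g t0) by rewrite gt0.
  have dl := @Ck_along_curve _ _ _ _ (fun s => stereo (n s) 0)
    (fun s => stereo (n s) 1) t0 _ _ oD (Ck_partial j hf) Dg (dx 0) (dx 1).
  have dr := is_deriveB (is_deriveZ k (dx i)) (is_derive_cst (c 0 i) t0 1).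
  have := eq_on_itv_derive AA t0A H dl dr.
  by rewrite subr0 -/(g t0) gt0.
have H0 := hessian 0 0 (fun s sA => let: And3 h _ _ := contact s sA in h).
have H1 := hessian 1 1 (fun s sA => let: And3 _ h _ := contact s sA in h).
have [_ _ HL] := contact t0 t0A.
have S := stereo_sqr (nn t0 t0A) n3.
have [px py] : stereo (n t0) 0 = x /\ stereo (n t0) 1 = y.
  by move: gt0 => /rowP gt0; split; [have := gt0 0|have := gt0 1]; rewrite !mxE.
rewrite px py in S.
(* Symmetry of second derivatives lets both rows share the entry [fxy]. *)
rewrite -(Ck_mixed oD hf Dxy) -/fx -/fy -/fxx -/fxy -/fyy in H0 H1.
rewrite gt0 /legendre !vec2E -/fx -/fy in HL.
exists (- a 1), (a 0); split.
(* If [a] vanished, so would [n'], since stereographic projection is an immersion. *)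
- have a0 i : a i = 0 -> n' 0 i = stereo (n t0) i * n' 0 2.
    by move/eqP; rewrite mulf_eq0 invr_eq0 (negPf n3) orbF subr_eq0 => /eqP.
  move=> [/eqP]; rewrite oppr_eq0 => /eqP /a0 e1 /a0 e0.
  by move/eqP: n'0; apply; exact: (stereo_immersion (nn _ t0A) nn' n3).
- by have [] := contact_algebra H0 H1 HL S.
- by have [] := contact_algebra H0 H1 HL S.
Qed.
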